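(* Let $f:\mathbb{D}\to\mathbb{D}$ be holomorphic, and let $V_f:H^2\to H^2\otimes\mathcal{H}(f)$ be the isometry with $V_fk_w=k_{f(w)}\otimes c_{f,w}$ and $\Phi_f(S)=V_f^{*}(S\otimes I_{\mathcal{H}(f)})V_f$ for $S\in B(H^2)$. Let $\mathcal{H}_{K_f}$ be the reproducing kernel Hilbert space of the kernel $$K_f\big((S,a),(T,b)\big)=\langle a,\Phi_f(S^{*}T)b\rangle\quad\text{on } B(H^2)\times H^2,$$ with sections $K_{f,(S,a)}$. Let $e_n(z)=z^n$ $(n\ge0)$, $E_{mn}h=e_m\langle e_n,h\rangle_{H^2}$, and let $\mathcal{H}_{\widehat K_f}$ be the reproducing kernel Hilbert space of the kernel $$\widehat K_f\big((m,a),(n,b)\big)=\langle a,\Phi_f(E_{mn})b\rangle\quad\text{on } \{0,1,2,\dots\}\times H^2,$$ with sections $\widehat K_{f,(n,a)}$. The map defined on kernel sections by $$\mathcal{U}_fK_{f,(S,a)}=\big(S\otimes I_{\mathcal{H}(f)}\big)V_fa$$ extends to a unitary $\mathcal{U}_f:\mathcal{H}_{K_f}\to H^2\otimes\mathcal{H}(f)$. For $n\ge0$ and $a\in H^2$, put $$\gamma_{n,a}=\big(\langle e_n,\cdot\rangle_{H^2}\otimes I_{\mathcal{H}(f)}\big)V_fa\in\mathcal{H}(f).$$ The map $$\widehat{\mathcal{U}}_f\widehat K_{f,(n,a)}=\gamma_{n,a}$$ extends to a unitary $\widehat{\mathcal{U}}_f:\mathcal{H}_{\widehat K_f}\to\mathcal{H}(f)$.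 In particular, for all $n\ge0$ and $w\in\mathbb{D}$, $$\gamma_{n,k_w}=\overline{f(w)}^{\,n}c_{f,w}.$$
   Context: All inner products are linear in the second variable. $\mathbb{D}$ is the open unit disk, $H^2$ its Hardy space with Szegő kernel $k(z,w)=\frac{1}{1-z\overline w}$, $k_w=k(\cdot,w)$, so $h(w)=\langle k_w,h\rangle$ for $h\in H^2$. The kernel $c_f(z,w)=\frac{1-f(z)\overline{f(w)}}{1-z\overline w}$ is positive definite on $\mathbb{D}$; its reproducing kernel Hilbert space is the de Branges-Rovnyak space $\mathcal{H}(f)$, and $c_{f,w}=c_f(\cdot,w)$. The isometry $V_f$ is well defined by its values on the kernel functions, and $\Phi_f$ is a normal unital completely positive map on $B(H^2)$. For a positive definite kernel $L$ on $X$, its reproducing kernel Hilbert space is the Hilbert space of functions on $X$ in which the sections $L_x:=L(\cdot,x)$ have dense linear span and $u(x)=\langle L_x,u\rangle$; in particular $\langle L_x,L_y\rangle=L(x,y)$. The kernels $K_f$ and $\widehat K_f$ are positive definite. $\langle e_n,\cdot\rangle_{H^2}\otimes I_{\mathcal{H}(f)}:H^2\otimes\mathcal{H}(f)\to\mathcal{H}(f)$ is the bounded operator with $x\otimes y\mapsto\langle e_n,x\rangle y$. *)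

(* Defs.v *)
From HB Require Import structures.
From mathcomp Require Import all_boot all_order all_algebra.
From mathcomp Require Import complex ring.
From mathcomp Require Import all_classical all_reals all_analysis.

Set Implicit Arguments.
Unset Strict Implicit.
Unset Printing Implicit Defensive.

Import Order.TTheory GRing.Theory Num.Theory.
Import numFieldNormedType.Exports.

Local Open Scope classical_set_scope.
Local Open Scope complex_scope.
Local Open Scope ring_scope.

(* Complex Hilbert spaces.  The inner product is conjugate-linear in its first
   argument and linear in the second, unlike the forms of sesquilinear.v.
   Positivity and definiteness come from ip_norm; the norm of a normed module
   over R[i] takes its values in R[i]. *)
HB.mixin Record isHilbert (R : realType) V of CompleteNormedModule R[i] V := {
  ip : V -> V -> R[i];
  ip_linear : forall x, scalar (ip x);
  ip_conj : forall x y, ip y x = (ip x y)^*;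
  ip_norm : forall x, ip x x = `|x| ^+ 2
}.

#[short(type="hilbertType")]
HB.structure Definition Hilbert (R : realType) :=
  {V of isHilbert R V & CompleteNormedModule R[i] V}.

Section InnerProduct.
Context {R : realType} {H : hilbertType R}.
Implicit Types x y z : H.

Lemma ipDr x y z : ip x (y + z) = ip x y + ip x z.
Proof. by have := ip_linear x 1 y z; rewrite scale1r mul1r. Qed.

Lemma ip0r x : ip x 0 = 0.
Proof. by apply: (addrI (ip x 0)); rewrite -ipDr !addr0. Qed.

Lemma ipZr a x y : ip x (a *: y) = a * ip x y.
Proof. by have := ip_linear x a y 0; rewrite addr0 ip0r addr0. Qed.

Lemma ipDl x y z : ip (x + y) z = ip x z + ip y z.
Proof. by rewrite ip_conj ipDr rmorphD /= -!ip_conj. Qed.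

Lemma ipZl a x y : ip (a *: x) y = a^* * ip x y.
Proof. by rewrite ip_conj ipZr rmorphM /= -ip_conj. Qed.

Lemma cauchy_schwarz x y : `|ip x y| <= `|x| * `|y|.
Proof.
have [->|x0] := eqVneq x 0; first by rewrite ip_conj ip0r conjC0 !normr0 mul0r.
have nx : 0 < `|x| by rewrite normr_gt0.
have : 0 <= `|(`|x| ^+ 2) *: y - ip x y *: x| ^+ 2 by rewrite exprn_ge0.
rewrite -ip_norm -scaleNr ipDl !ipDr !ipZl !ipZr !ip_norm (ip_conj x y).
rewrite !rmorphN /= rmorphXn /= (CrealP (normr_real x)).
have -> : `|x| ^+ 2 * (`|x| ^+ 2 * `|y| ^+ 2) +
    `|x| ^+ 2 * (- ip x y * (ip x y)^*) +
    (- (ip x y)^* * (`|x| ^+ 2 * ip x y) +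
     - (ip x y)^* * (- ip x y * `|x| ^+ 2)) =
    `|x| ^+ 2 * ((`|x| * `|y|) ^+ 2 - `|ip x y| ^+ 2).
  by rewrite (normCK (ip x y)); ring.
by rewrite pmulr_rge0 ?exprn_gt0// subr_ge0 ler_sqr ?nnegrE ?mulr_ge0.
Qed.

End InnerProduct.

Section BoundedOperators.
Context {R : realType}.
Implicit Types E F G : hilbertType R.

Record bop E F := Bop { bop_fun :> {linear E -> F}; _ : continuous bop_fun }.

HB.instance Definition _ E F := gen_eqMixin (bop E F).
HB.instance Definition _ E F := gen_choiceMixin (bop E F).

Lemma cst0_continuous E F : continuous (\0 : E -> F).
Proof. by move=> x; exact: cvg_cst. Qed.

Definition bop0 E F : bop E F := Bop (@cst0_continuous E F).

Lemma bcomp_subproof E F G (A : bop F G) (B : bop E F) :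
  continuous ((A : {linear F -> G}) \o (B : {linear E -> F})).
Proof.
by case: A B => A cA [B cB] x; apply: continuous_comp; [exact: cB|exact: cA].
Qed.

Definition bcomp E F G (A : bop F G) (B : bop E F) : bop E G :=
  Bop (@bcomp_subproof E F G A B).

(* The rank one operator h |-> y <x, h>. *)
Definition rank1_fun E F (y : F) (x : E) (h : E) : F := ip x h *: y.

Lemma rank1_linear E F (y : F) (x : E) : linear (rank1_fun y x).
Proof. by move=> a u v; rewrite /rank1_fun ip_linear scalerDl scalerA. Qed.

HB.instance Definition _ E F (y : F) (x : E) :=
  GRing.isLinear.Build R[i] E F *:%R (rank1_fun y x) (rank1_linear y x).

Lemma rank1_continuous E F (y : F) (x : E) : continuous (rank1_fun y x).
Proof.
apply: bounded_linear_continuous; apply/bounded_funP => r.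
exists (`|x| * r * `|y|) => h hr.
rewrite normrZ ler_wpM2r// (le_trans (cauchy_schwarz _ _))//.
by rewrite ler_wpM2l.
Qed.

Definition rank1 E F (y : F) (x : E) : bop E F :=
  Bop (@rank1_continuous E F y x).

(* The adjoint, which exists and is unique. *)
Definition adj E F (A : bop E F) : bop F E :=
  xget (bop0 F E) [set B | forall x y, ip (A x) y = ip x (B y)].

Definition isometric E F (U : bop E F) := forall x y, ip (U x) (U y) = ip x y.

Definition unitary E F (U : bop E F) :=
  isometric U /\ forall y, exists x, U x = y.

Definition lin_span E (A : set E) : set E :=
  [set u | exists (n : nat) (c : 'I_n -> R[i]) (x : 'I_n -> E),
     (forall i, A (x i)) /\ u = \sum_(i < n) c i *: x i].

End BoundedOperators.

Section TensorProduct.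
Context {R : realType}.
Implicit Types E F : hilbertType R.

(* A Hilbert space tensor product of E and F (unique up to unitary). *)
Record tensorProduct E F := TensorProduct {
  tensor_space :> hilbertType R;
  tens : E -> F -> tensor_space;
  tens_linearl : forall y, linear (tens^~ y);
  tens_linearr : forall x, linear (tens x);
  tens_ip : forall x y x' y',
    ip (tens x y) (tens x' y') = ip x x' * ip y y';
  tens_dense : dense (lin_span [set t | exists x y, t = tens x y])
}.

Context {E F : hilbertType R} (T : tensorProduct E F).

(* S \otimes I, the unique bounded operator with x \otimes y |-> S x \otimes y. *)
Definition tensI (S : bop E E) : bop T T :=
  xget (bop0 T T)
    [set A : bop T T | forall x y, A (tens T x y) = tens T (S x) y].

(* <e, .> \otimes I, the unique bounded operator with x \otimes y |-> <e, x> y. *)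
Definition braI (e : E) : bop T F :=
  xget (bop0 T F) [set A : bop T F | forall x y, A (tens T x y) = ip e x *: y].

End TensorProduct.

Section FunctionSpaces.
Context {R : realType}.

(* A Hilbert space whose elements are (via feval) complex functions on X. *)
Record funSpace (X : Type) := FunSpace {
  funspace_space :> hilbertType R;
  feval : funspace_space -> X -> R[i];
  feval_linear : forall x, scalar (feval^~ x);
  feval_inj : forall u v, (forall x, feval u x = feval v x) -> u = v
}.

(* The reproducing kernel Hilbert space of L; sect x is L(., x). *)
Record rkhs (X : Type) (L : X -> X -> R[i]) := Rkhs {
  rkhs_space :> funSpace X;
  sect : X -> rkhs_space;
  feval_sect : forall x y, feval (sect y) x = L x y;
  feval_repr : forall u x, feval u x = ip (sect x) u;
  sect_dense : dense (lin_span (range sect))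
}.

(* The element of H that is the function g, when there is one. *)
Definition elt_of X (H : funSpace X) (g : X -> R[i]) : H :=
  xget 0 [set h | forall x, feval h x = g x].

End FunctionSpaces.

Section Disk.
Variable R : realType.

Definition disk := {z : R[i] | `|z| < 1}.

(* Extension by zero, in order to use derivable at the points of the open disk;
   over the scalar field R[i] this is complex differentiability. *)
Definition disk_ext (f : disk -> disk) (z : R[i]) : R[i] :=
  if insub z is Some w then val (f w) else 0.

Definition holomorphic (f : disk -> disk) := forall w : disk,
  derivable (disk_ext f : R[i]^o -> R[i]^o) (val w : R[i]^o) 1.

Definition szego (z w : disk) : R[i] := (1 - val z * (val w)^*)^-1.

Definition dbr_kernel (f : disk -> disk) (z w : disk) : R[i] :=
  (1 - val (f z) * (val (f w))^*) / (1 - val z * (val w)^*).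

Definition power_series (a : nat -> R[i]) (h : disk -> R[i]) := forall z,
  series (fun n => a n * val z ^+ n : R[i]^o) @ \oo --> (h z : R[i]^o).

(* The Hardy space: power series on the disk with square-summable coefficients,
   normed by the l^2 norm of the coefficients. *)
Record hardySpace := HardySpace {
  hardy_space :> funSpace (R := R) disk;
  hardy_series : forall h : hardy_space, exists a, power_series a (feval h);
  hardy_full : forall a, cvgn (series (fun n => `|a n| ^+ 2 : R[i]^o)) ->
    exists h : hardy_space, power_series a (feval h);
  hardy_ip : forall (g h : hardy_space) a b,
    power_series a (feval g) -> power_series b (feval h) ->
    series (fun n => (a n)^* * b n : R[i]^o) @ \oo --> (ip g h : R[i]^o)
}.

Context (H2 : hardySpace).

Definition szego_at (w : disk) : H2 := elt_of H2 (fun z => szego z w).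

Definition monom (n : nat) : H2 := elt_of H2 (fun z => val z ^+ n).

Definition matunit (m n : nat) : bop H2 H2 := rank1 (monom m) (monom n).

End Disk.

Section Kernels.
Context {R : realType} (H2 : hardySpace R) (Hf : hilbertType R)
  (T : tensorProduct H2 Hf) (V : bop H2 T).

Definition Phi (S : bop H2 H2) : bop H2 H2 :=
  bcomp (adj V) (bcomp (tensI T S) V).

Definition Kf (p q : bop H2 H2 * H2) : R[i] :=
  ip p.2 (Phi (bcomp (adj p.1) q.1) q.2).

Definition Khat (p q : nat * H2) : R[i] :=
  ip p.2 (Phi (matunit H2 p.1 q.1) q.2).

Definition gam (n : nat) (a : H2) : Hf := braI T (monom H2 n) (V a).

End Kernels.

(* Main.v *)
(** The analytic input is the existence of adjoints for linear relations that are
    bounded and densely defined; adjoints, isometries prescribed on a total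
    family, and the operators [S \otimes I] and [<e, .> \otimes I] all come from
    it.  With these, [K_f((S,a),(T,b)) = <(S \otimes I) V a, (T \otimes I) V b>]
    and, as [E_mn = rank1 e_m e_n], the kernel [\hat K_f] is the Gram kernel of
    the [gamma_(n,a)], so both maps are isometric.  They are onto because a vector
    orthogonal to the range vanishes: for [S = x <e_0, .>], [S \otimes I] sends
    [V k_w] to [x \otimes c_(f,w)], and [gamma_(0,k_w) = c_(f,w)]. *)
From HB Require Import structures.
Require Import Defs.
From mathcomp Require Import all_boot all_order all_algebra.
From mathcomp Require Import complex ring.
From mathcomp Require Import all_classical all_reals all_analysis.

Set Implicit Arguments.
Unset Strict Implicit.
Unset Printing Implicit Defensive.

Import Order.TTheory GRing.Theory Num.Theory.
Import numFieldNormedType.Exports.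

Local Open Scope classical_set_scope.
Local Open Scope complex_scope.
Local Open Scope ring_scope.

(** * Vectors tested against dense and total sets *)

Section HilbertBasics.
Context {R : realType} {H : hilbertType R}.
Implicit Types x y z : H.

Lemma ipNr x y : ip x (- y) = - ip x y.
Proof. by rewrite -scaleN1r ipZr mulN1r. Qed.

Lemma ipBr x y z : ip x (y - z) = ip x y - ip x z.
Proof. by rewrite ipDr ipNr. Qed.

Lemma ip0l x : ip 0 x = 0.
Proof. by rewrite ip_conj ip0r conjC0. Qed.

Lemma ipNl x y : ip (- x) y = - ip x y.
Proof. by rewrite ip_conj ipNr rmorphN /= -ip_conj. Qed.

Lemma ipBl x y z : ip (x - y) z = ip x z - ip y z.
Proof. by rewrite ipDl ipNl. Qed.

Lemma ip_sumr x n (y : 'I_n -> H) : ip x (\sum_i y i) = \sum_i ip x (y i).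
Proof. by elim/big_rec2: _ => [|i u v _ <-]; rewrite ?ip0r ?ipDr. Qed.

Lemma ip_suml x n (y : 'I_n -> H) : ip (\sum_i y i) x = \sum_i ip (y i) x.
Proof. by elim/big_rec2: _ => [|i u v _ <-]; rewrite ?ip0l ?ipDl. Qed.

Lemma ip_eq0 x : ip x x = 0 -> x = 0.
Proof. by rewrite ip_norm => /eqP; rewrite expf_eq0 normr_eq0 => /eqP. Qed.

Lemma ip_inj x y : (forall z, ip z x = ip z y) -> x = y.
Proof.
move=> xy; apply/eqP; rewrite -subr_eq0; apply/eqP/ip_eq0.
by rewrite ipBr xy subrr.
Qed.

Lemma dense_approx (D : set H) x (e : R[i]) : dense D -> 0 < e ->
  exists2 u, D u & `|x - u| < e.
Proof.
move=> dD e0; have xx : ball x e x by exact: ballxx.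
have [] := dD (ball x e) (ex_intro _ x xx).
  exact: ball_open.
by move=> u []; rewrite -ball_normE /= => ? ?; exists u.
Qed.

(** If [x] were nonzero, a point [u] of [D] at distance less than [|x|] from [x] would give
    [|x|^2 = |<x - u, x>| < |x|^2] by Cauchy-Schwarz. *)
Lemma dense_ip_eq0 (D : set H) x : dense D -> (forall u, D u -> ip u x = 0) ->
  x = 0.
Proof.
move=> dD Dx; apply/eqP; apply: contraT => x0.
have x_gt0 : 0 < `|x| by rewrite normr_gt0.
have [u Du ux] := dense_approx x dD x_gt0.
suff : `|x| ^+ 2 < `|x| ^+ 2 by rewrite ltxx.
have {1}-> : `|x| ^+ 2 = `|ip (x - u) x|.
  by rewrite ipBl (Dx u)// subr0 ip_norm ger0_norm// exprn_ge0.
by rewrite (le_lt_trans (cauchy_schwarz _ _))// expr2 ltr_pM2r.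
Qed.

Lemma lin_span_ip_eq0 (A : set H) x : (forall u, A u -> ip u x = 0) ->
  forall u, lin_span A u -> ip u x = 0.
Proof.
move=> Ax u [n [c [y [Ay ->]]]]; rewrite ip_suml big1// => i _.
by rewrite ipZl Ax ?mulr0.
Qed.

Lemma total_ip_eq0 (A : set H) x : dense (lin_span A) ->
  (forall u, A u -> ip u x = 0) -> x = 0.
Proof. by move=> dA Ax; apply: (dense_ip_eq0 dA); exact: lin_span_ip_eq0. Qed.

Lemma total_ip_inj (A : set H) x y : dense (lin_span A) ->
  (forall u, A u -> ip u x = ip u y) -> x = y.
Proof.
move=> dA Axy; apply/eqP; rewrite -subr_eq0; apply/eqP.
by apply: (total_ip_eq0 dA) => u Au; rewrite ipBr Axy ?subrr.
Qed.

End HilbertBasics.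

(** * Limits of sequences with a harmonic Cauchy rate *)

Lemma invSn_complex (R : realType) (e : R[i]) : 0 < e ->
  exists n, n.+1%:R^-1 < e.
Proof.
case: e => a b; rewrite ltcE /= => /andP[/eqP-> a0].
have [k ka] := ltr_add_invr a0; exists k.
rewrite add0r -ltcR in ka; apply: le_lt_trans ka.
by rewrite fmorphV /= rmorph_nat.
Qed.

(** Completeness gives the limit; letting [m] grow in the hypothesis with [n] fixed leaves the rate
    [1/(n+1)]. *)
Lemma harmonic_cauchy_lim (R : realType) (H : hilbertType R) (u : nat -> H) :
    (forall n m, `|u n - u m| <= n.+1%:R^-1 + m.+1%:R^-1) ->
  exists l, forall n, `|u n - l| <= n.+1%:R^-1.
Proof.
move=> uc.
have small e : 0 < e -> \forall n \near \oo, n.+1%:R^-1 < e :> R[i].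
  move=> /invSn_complex[n0 n0e]; exists n0 => // n /= n0n.
  by apply: le_lt_trans n0e; rewrite lef_pV2 ?posrE ?ltr0n// ler_nat.
have /cauchy_cvgP/cvg_ex[/= l ul] : cauchy (u @ \oo).
  apply/cauchy_exP => e e0.
  have [n ne] := invSn_complex (divr_gt0 e0 (ltr0Sn _ 1)).
  exists (u n).
  suff : \forall m \near \oo, ball (u n) e (u m) by [].
  near=> m; rewrite -ball_normE /= (le_lt_trans (uc _ _))// (splitr e) ltrD//.
  by near: m; apply: small; rewrite divr_gt0.
exists l => n; apply/ler_addgt0Pl => e e0.
have [m [me ml]] : exists m, m.+1%:R^-1 < e / 2 /\ `|l - u m| < e / 2.
  apply: (@filter_ex _ (\oo : set_system nat)); near=> m; split.
    by near: m; apply: small; rewrite divr_gt0.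
  near: m; move/cvgrPdist_lt : ul; apply; by rewrite divr_gt0.
rewrite -(subrK (u m) (u n)) -addrA (le_trans (ler_normD _ _))//.
rewrite (distrC (u m)) (splitr e) (le_trans (lerD (uc n m) (ltW ml)))//.
by rewrite -addrA addrC lerD2r lerD2r ltW.
Unshelve. all: by end_near. Qed.

(** Completing the square for the functional minimized in [approx_adjoint]: primes stand for
    conjugates, [n = |u|^2], [a = |x|^2], [b = <f, v>], [c = <f, y>] and [z = <x, u> - <f, v>]. *)
Fact energy_identity (K : fieldType) (n a z z' b b' c c' : K) : n != 0 ->
  - z / n * (- z' / n * n) + - z / n * (z' + b') + (- z' / n * (z + b) + a) -
    (- z' / n * b + c + (- z / n * b' + c')) = a - (c + c') - z * z' / n.
Proof. by move=> n0; field. Qed.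

(** * Continuity and norm bounds of linear maps *)

Section BoundedLinear.
Context {R : realType} {E F : hilbertType R}.

Lemma bop_bound (A : bop E F) :
  exists2 M : R[i], 0 <= M & forall x, `|A x| <= M * `|x|.
Proof.
case: A => A /= cA.
have /linear_boundedP[M [Mreal AM]] : bounded_near A (nbhs (0 : E)).
  by apply/linear_bounded_continuous.
(* Only numbers strictly above [M] are known to be bounds, and [M] may be negative. *)
exists (`|M| + 1); first by rewrite addr_ge0.
by apply: AM; rewrite ltr_pwDr// real_ler_norm.
Qed.

Lemma bop_of_bound (A : E -> F) (M : R[i]) : 0 <= M -> linear A ->
  (forall x, `|A x| <= M * `|x|) -> exists B : bop E F, forall x, B x = A x.
Proof.
move=> M0 lA AM.
pose L := GRing.isLinear.Build R[i] E F *:%R A lA.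
pose B : {linear E -> F} := HB.pack A L.
have cB : continuous B.
  apply: bounded_linear_continuous; apply/bounded_funP => r.
  by exists (M * r) => x xr; rewrite (le_trans (AM x))// ler_wpM2l.
by exists (Bop cB).
Qed.

End BoundedLinear.

(** * The adjoint of a bounded, densely defined linear relation *)

Section AdjointRelation.
Context {R : realType} {E F : hilbertType R}.
Implicit Types (u : E) (v f : F).
(** A relation, rather than a map, covers assignments on linear combinations that are not yet known
    to be well defined; [P_bound] forces [v = 0] when [u = 0]. *)
Variables (P : E -> F -> Prop) (M : R[i]).
Hypothesis P_linear : forall a u v u' v', P u v -> P u' v' ->
  P (a *: u + u') (a *: v + v').
Hypothesis M_ge0 : 0 <= M.
Hypothesis P_bound : forall u v, P u v -> `|v| <= M * `|u|.
Hypothesis P_dense : dense [set u | exists v, P u v].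

(* Minimizing [|u|^2 - 2 Re <f, v>] over the relation; [x] is within [e ^+ 2] of
   the infimum. *)
Lemma approx_adjoint f (e : R) : 0 < e -> exists x y, P x y /\
  forall u v, P u v -> `|ip x u - ip f v| <= e%:C * `|u|.
Proof.
move=> e0.
pose q u v : R[i] := `|u| ^+ 2 - (ip f v + (ip f v)^*).
have q_real u v : q u v \is Num.real.
  rewrite rpredB//; first by rewrite ger0_real// exprn_ge0.
  by rewrite CrealE rmorphD /= conjCK addrC.
(* The values of [q] are real and are moved to [R], where the infimum is taken. *)
pose Q : set R := [set r | exists u v, P u v /\ r%:C = q u v].
have Q_inf : has_inf Q.
  split.
    have [u [v Puv] _] := dense_approx 0 P_dense (ltr01 : 0 < 1 :> R[i]).
    have /complex_realP[r qr] := q_real u v.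
    by exists r, u, v.
  (* This lower bound comes from [(|u| - M |f|)^2 >= 0], since [2 Re <f, v> <= 2 M |u| |f|]. *)
  have /complex_realP[b bE] : - (M * `|f|) ^+ 2 \is Num.real.
    by rewrite rpredN ger0_real// exprn_ge0// mulr_ge0.
  exists b => r [u [v [Puv rE]]]; rewrite -lecR rE -bE.
  have fv : ip f v + (ip f v)^* <= 2 * (`|u| * (M * `|f|)).
    rewrite (le_trans (real_ler_norm _))//.
      by rewrite CrealE rmorphD /= conjCK addrC.
    rewrite (le_trans (ler_normD _ _))// norm_conjC -mulr2n -[leLHS]mulr_natl.
    rewrite ler_pM2l// (le_trans (cauchy_schwarz _ _))// mulrC.
    by rewrite mulrA ler_wpM2r// mulrC P_bound.
  rewrite -subr_ge0 opprK -addrAC subr_ge0 (le_trans fv)// -subr_ge0.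
  have -> : `|u| ^+ 2 + (M * `|f|) ^+ 2 - 2 * (`|u| * (M * `|f|)) =
    (`|u| - M * `|f|) ^+ 2 by ring.
  by rewrite real_exprn_even_ge0// rpredB// ger0_real// mulr_ge0.
have [r [x [y [Pxy rE]]] r_inf] := inf_adherent (exprn_gt0 2 e0) Q_inf.
exists x, y; split=> // u v Puv.
have [u0|u0] := eqVneq u 0.
  have : `|v| <= 0 by rewrite (le_trans (P_bound Puv))// u0 normr0 mulr0.
  rewrite normr_le0 => /eqP v0.
  by rewrite u0 v0 !ip0r subrr !normr0 mulr0.
have nu0 : 0 < `|u| by rewrite normr_gt0.
set z := ip x u - ip f v.
(* The minimizer of [q] on the line through [x] in the direction [u]. It lowers [q] by
   [|z|^2 / |u|^2], which near-minimality of [x] keeps below [e^2]. *)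
pose t := - z^* / `|u| ^+ 2.
have tC : t^* = - z / `|u| ^+ 2.
  rewrite rmorphM fmorphV rmorphN /= conjCK rmorphXn /=.
  by rewrite (CrealP (normr_real u)).
have qt : q (t *: u + x) (t *: v + y) = q x y - `|z| ^+ 2 / `|u| ^+ 2.
  rewrite /q -!ip_norm !ipDl !ipDr !ipZl !ipZr (ip_conj x u) ip_norm tC.
  rewrite rmorphD rmorphM /= tC.
  have -> : ip x u = z + ip f v by rewrite /z subrK.
  rewrite rmorphD /= normCK /t.
  by rewrite energy_identity// expf_eq0 normr_eq0.
have /complex_realP[s sE] := q_real (t *: u + x) (t *: v + y).
have : inf Q <= s.
  by apply: ge_inf; [exact: Q_inf.2|exists (t *: u + x), (t *: v + y); split=> //;
    exact: P_linear].
move=> /(lt_le_trans _) => /(_ (r - e ^+ 2)); rewrite ltrBlDr => /(_ r_inf).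
rewrite -ltcR rmorphB /= rmorphXn /= rE -sE qt ltrD2l ltrN2.
rewrite ltr_pdivrMr ?exprn_gt0// -exprMn => /ltW.
by rewrite ler_sqr// nnegrE mulr_ge0// ler0c ltW.
Qed.

(** Near-minimizers with errors [1/(n+1)] form a Cauchy sequence, and their limit represents
    [<f, v>] exactly. Density of the domain then gives linearity and the bound [M]. *)
Lemma adjoint_relation : exists B : bop F E,
  forall u v f, P u v -> ip (B f) u = ip f v.
Proof.
have P_sub u v u' v' : P u v -> P u' v' -> P (u' - u) (v' - v).
  move=> Puv Puv'; have := P_linear (-1) Puv Puv'.
  by rewrite !scaleN1r ![- _ + _]addrC.
have /choice[B BE] f : exists x, forall u v, P u v -> ip x u = ip f v.
  have inv_gt0 n : 0 < n.+1%:R^-1 :> R by rewrite invr_gt0.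
  have /choice[x /choice[y xyP]] n := approx_adjoint f (inv_gt0 n).
  have xP n : P (x n) (y n) by have [] := xyP n.
  have {xyP}xE n u v : P u v -> `|ip (x n) u - ip f v| <= n.+1%:R^-1 * `|u|.
    have [_] := xyP n; rewrite fmorphV /= rmorph_nat; exact.
  have [n m|l xl] := @harmonic_cauchy_lim _ _ x.
    have [->|] := eqVneq (x n) (x m).
      by rewrite subrr normr0 addr_ge0// invr_ge0.
    rewrite -subr_eq0 -normr_gt0 => nm0.
    (* Both near-minimizers are tested on their own difference, which lies in the domain of [P];
       dividing by its norm gives the Cauchy rate. *)
    have Pnm := P_sub _ _ _ _ (xP m) (xP n).
    rewrite -(ler_pM2r nm0) -expr2 -ip_norm mulrDl.
    rewrite -[leLHS]ger0_norm ?ip_norm ?exprn_ge0// -ip_norm ipBl.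
    rewrite -[X in X - _](subrK (ip f (y n - y m))) -addrA.
    rewrite (le_trans (ler_normD _ _))// lerD ?xE//.
    by rewrite distrC xE.
  exists l => u v Puv; apply/eqP; rewrite -subr_eq0 -normr_le0.
  apply/ler_addgt0Pl => e e0; rewrite addr0.
  (* The factor 2 splits [e] between the two errors; adding 1 to [|u|] allows [u = 0]. *)
  have [n ne] : exists n, n.+1%:R^-1 < e / (2 * (`|u| + 1)).
    by apply: invSn_complex; rewrite divr_gt0// mulr_gt0// ltr_wpDl.
  rewrite -[X in X - _](subrK (ip (x n) u)) -addrA -ipBl.
  rewrite (le_trans (ler_normD _ _))//.
  rewrite (le_trans (lerD (cauchy_schwarz _ _) (xE n _ _ Puv)))// -mulrDl.
  have le2 : `|l - x n| + n.+1%:R^-1 <= e / (`|u| + 1).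
    have -> : e / (`|u| + 1) = e / (2 * (`|u| + 1)) + e / (2 * (`|u| + 1)).
      by field; rewrite gt_eqF// ltr_wpDl.
    by rewrite lerD// ?(ltW ne)// distrC (le_trans (xl n))// ltW.
  rewrite (le_trans (ler_wpM2r _ le2))//.
  by rewrite mulrAC ler_pdivrMr ?ltr_wpDl// ler_pM2l// lerDl.
have BE' u v f : P u v -> ip u (B f) = ip v f.
  by move=> Puv; rewrite ip_conj (BE f _ _ Puv) -ip_conj.
have BM f : `|B f| <= M * `|f|.
  have [->|] := eqVneq (B f) 0; first by rewrite normr0 mulr_ge0.
  rewrite -normr_gt0 => b0; rewrite -(ler_pM2r b0) -expr2 -ip_norm.
  rewrite -[leLHS]ger0_norm ?ip_norm ?exprn_ge0// -ip_norm.
  apply/ler_addgt0Pl => e e0.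
  have c0 : 0 < `|B f| + M * `|f| by rewrite ltr_pwDl// mulr_ge0.
  (* With [d] this tolerance, [|B f|^2 <= d |B f| + M |f| (d + |B f|)], and the right side is
     [M |f| |B f| + e]. *)
  have [u [v Puv] Bu] := dense_approx (B f) P_dense (divr_gt0 e0 c0).
  rewrite -[X in ip _ X](subrK u) ipDr (BE _ _ _ Puv).
  rewrite (le_trans (ler_normD _ _))//.
  rewrite (le_trans (lerD (cauchy_schwarz _ _) (cauchy_schwarz _ _)))//.
  have ub : `|u| <= e / (`|B f| + M * `|f|) + `|B f|.
    rewrite -{1}(subrK (B f) u) (le_trans (ler_normD _ _))// lerD2r distrC.
    exact: ltW.
  have vb := le_trans (P_bound Puv) (ler_wpM2l M_ge0 ub).
  rewrite (le_trans (lerD (ler_wpM2l _ (ltW Bu)) (ler_wpM2l _ vb)))//.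
  rewrite le_eqVlt; apply/orP; left; apply/eqP; field.
  by rewrite gt_eqF.
have Blin : linear B.
  move=> a f g; apply/eqP; rewrite -subr_eq0; apply/eqP.
  apply: (dense_ip_eq0 P_dense) => u [v Puv].
  by rewrite ipBr ipDr ipZr !(BE' _ _ _ Puv) ipDr ipZr subrr.
have [A AE] := bop_of_bound M_ge0 Blin BM.
by exists A => u v f Puv; rewrite AE; exact: BE.
Qed.

End AdjointRelation.

(** * Adjoints, and operators prescribed on total families *)

Section Adjoint.
Context {R : realType}.
Implicit Types E F : hilbertType R.

(** The graph of [A] is a bounded linear relation with full domain, so the [xget] in [adj] finds a
    genuine adjoint instead of its default [bop0]. *)
Lemma adjP E F (A : bop E F) x y : ip (A x) y = ip x (adj A y).
Proof.
suff [B AB] : exists B : bop F E, forall x y, ip (A x) y = ip x (B y).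
  exact: (@xgetPex _ (bop0 F E) [set B | forall x y, ip (A x) y = ip x (B y)]
    (ex_intro _ B AB)).
have [M M0 AM] := bop_bound A.
have [||u v||B BA] := @adjoint_relation _ E F (fun u v => v = A u) M.
- by move=> a u v u' v' -> ->; rewrite linearP.
- exact: M0.
- by move=> ->; exact: AM.
- move=> O O0 _; rewrite (_ : [set _ | _] = setT) ?setIT//.
  by apply/seteqP; split=> // u _; exists (A u).
by exists B => {}x {}y; rewrite ip_conj -(BA _ _ y erefl) -ip_conj.
Qed.

Lemma adjPr E F (A : bop E F) x y : ip y (A x) = ip (adj A y) x.
Proof. by rewrite ip_conj adjP -ip_conj. Qed.

Lemma bop_total E F (S : set E) (A B : bop E F) : dense (lin_span S) ->
  (forall u, S u -> A u = B u) -> forall x, A x = B x.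
Proof.
move=> dS AB x; apply: ip_inj => y; rewrite !adjPr; congr (ip _ x).
by apply: (total_ip_inj dS) => u Su; rewrite -!adjP AB.
Qed.

(** Pairs of combinations with equal coefficients form a linear relation, whether or not
    [g i |-> h i] respects linear dependencies. *)
Lemma bop_of_family E F (I : Type) (g : I -> E) (h : I -> F) (M : R[i]) :
    0 <= M -> dense (lin_span (range g)) ->
    (forall n (c : 'I_n -> R[i]) (i : 'I_n -> I),
      `|\sum_k c k *: h (i k)| <= M * `|\sum_k c k *: g (i k)|) ->
  exists A : bop E F, forall i, A (g i) = h i.
Proof.
move=> M0 dg hM.
pose P u v := exists n (c : 'I_n -> R[i]) (i : 'I_n -> I),
  u = \sum_k c k *: g (i k) /\ v = \sum_k c k *: h (i k).
have [||u v||B BP] := @adjoint_relation _ E F P M.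
- move=> a u v u' v' [n [c [i [-> ->]]]] [m [d [j [-> ->]]]].
  pose cd (k : 'I_(n + m)) :=
    match fintype.split k with inl k => a * c k | inr k => d k end.
  pose ij (k : 'I_(n + m)) :=
    match fintype.split k with inl k => i k | inr k => j k end.
  have splitl (k : 'I_n) : fintype.split (lshift m k) = inl k.
    exact: (unsplitK (inl k)).
  have splitr (k : 'I_m) : fintype.split (rshift n k) = inr k.
    exact: (unsplitK (inr k)).
  exists (n + m)%N, cd, ij.
  by split; rewrite big_split_ord /= scaler_sumr; congr (_ + _);
    apply: eq_bigr => k _; rewrite /cd /ij ?splitl ?splitr ?scalerA.
- exact: M0.
- by move=> [n [c [i [-> ->]]]].
- move=> O O0 oO; have [u [Ou [n [c [x [xg uE]]]]]] := dg O O0 oO.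
  have /choice[i iE] k : exists i, g i = x k.
    by have [i _ ix] := xg k; exists i.
  exists u; split=> //; exists (\sum_k c k *: h (i k)), n, c, i; split=> //.
  by rewrite uE; apply: eq_bigr => k _; rewrite iE.
(* [B] is the adjoint of the relation, so its own adjoint extends the relation. *)
exists (adj B) => i; apply: ip_inj => f; rewrite -adjP; apply: BP.
by exists 1%N, (fun=> 1), (fun=> i); rewrite !big_ord1 !scale1r.
Qed.

(* The range of an isometry [U] is the orthogonal complement of the kernel of
   [adj U], since [y - U (adj U y)] is orthogonal to it. *)
Lemma unitary_of_family E F (I : Type) (g : I -> E) (h : I -> F) :
    dense (lin_span (range g)) -> (forall i j, ip (h i) (h j) = ip (g i) (g j)) ->
    (forall y, (forall i, ip (h i) y = 0) -> y = 0) ->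
  exists U : bop E F, unitary U /\ forall i, U (g i) = h i.
Proof.
move=> dg gram h0.
have [||n c i|U UE] := @bop_of_family E F I g h 1 => //.
  rewrite mul1r -ler_sqr ?nnegrE// -!ip_norm le_eqVlt; apply/orP; left; apply/eqP.
  rewrite !ip_suml; apply: eq_bigr => k _; rewrite !ip_sumr.
  by apply: eq_bigr => l _; rewrite !ipZl !ipZr gram.
exists U; split=> //.
have adjUE i : adj U (h i) = g i.
  by apply: (total_ip_inj dg) => _ [j _ <-]; rewrite -adjP UE gram.
have UK x : adj U (U x) = x.
  apply: (total_ip_inj dg) => _ [j _ <-].
  by rewrite -adjP UE adjPr adjUE.
split=> [x y|y]; first by rewrite adjP UK.
exists (adj U y); apply/esym/eqP; rewrite -subr_eq0; apply/eqP/h0 => i.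
by rewrite -UE adjP linearB /= UK subrr ip0r.
Qed.

End Adjoint.

(** * Operators on the Hilbert space tensor product *)

Section Tensor.
Context {R : realType} {E F : hilbertType R} (T : tensorProduct E F).
Implicit Types (x e : E) (y : F) (S : bop E E).

HB.instance Definition _ x :=
  GRing.isLinear.Build R[i] F T *:%R (tens T x) (tens_linearr T x).

Lemma tensDl x x' y : tens T (x + x') y = tens T x y + tens T x' y.
Proof. by have := tens_linearl T y 1 x x'; rewrite !scale1r. Qed.

Lemma tens0l y : tens T 0 y = 0.
Proof. by apply: (addrI (tens T 0 y)); rewrite -tensDl !addr0. Qed.

Lemma tensZl a x y : tens T (a *: x) y = a *: tens T x y.
Proof. by have := tens_linearl T y a x 0; rewrite tens0l !addr0. Qed.

Lemma tens_suml n (x : 'I_n -> E) y :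
  tens T (\sum_i x i) y = \sum_i tens T (x i) y.
Proof. by elim/big_rec2: _ => [|i u v _ <-]; rewrite ?tens0l ?tensDl. Qed.

Lemma norm_tens x y : `|tens T x y| = `|x| * `|y|.
Proof.
apply/eqP; rewrite -(@eqrXn2 _ 2) ?mulr_ge0//.
by rewrite exprMn -!ip_norm tens_ip.
Qed.

Lemma tens_total_ip t t' :
  (forall x y, ip (tens T x y) t = ip (tens T x y) t') -> t = t'.
Proof.
by move=> tt'; apply: (total_ip_inj (@tens_dense _ _ _ T)) => _ [x [y ->]].
Qed.

Lemma bop_tens_ext (G : hilbertType R) (A B : bop T G) :
  (forall x y, A (tens T x y) = B (tens T x y)) -> forall t, A t = B t.
Proof. by move=> AB; apply: (bop_total (@tens_dense _ _ _ T)) => _ [x [y ->]]. Qed.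

(* Gram-Schmidt on the second factors: splitting [y i] along [y 0] makes the
   term at [y 0] orthogonal to the other ones. *)
Lemma tens_sum_bound S (M : R[i]) n (x : 'I_n -> E) (y : 'I_n -> F) :
    0 <= M -> (forall x, `|S x| <= M * `|x|) ->
  `|\sum_i tens T (S (x i)) (y i)| <= M * `|\sum_i tens T (x i) (y i)|.
Proof.
move=> M0 SM; rewrite -ler_sqr ?nnegrE ?mulr_ge0// exprMn.
elim: n x y => [|n IHn] x y.
  by rewrite !big_ord0 normr0 expr0n mulr0.
rewrite !big_ord_recl; set x0 := x ord0; set y0 := y ord0.
have [->|y0N0] := eqVneq y0 0; first by rewrite !linear0 !add0r.
pose a i := ip y0 (y (lift ord0 i)) / `|y0| ^+ 2.
pose y' i := y (lift ord0 i) - a i *: y0.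
have y0y' i : ip y0 (y' i) = 0.
  by rewrite ipBr ipZr ip_norm divfK ?subrr// expf_eq0 normr_eq0.
(* Stated for any [x'] to serve both [x] and [S \o x]: the [a i] depend on [y] only, so [S] commutes
   with the regrouping. *)
have split_sum (x' : 'I_n.+1 -> E) :
    tens T (x' ord0) y0 + \sum_(i < n) tens T (x' (lift ord0 i)) (y (lift ord0 i))
    = tens T (x' ord0 + \sum_(i < n) a i *: x' (lift ord0 i)) y0
      + \sum_(i < n) tens T (x' (lift ord0 i)) (y' i).
  rewrite tensDl -addrA tens_suml -big_split /=; congr (_ + _).
  apply: eq_bigr => i _; rewrite -[y _](subrK (a i *: y0)) -/(y' i).
  by rewrite linearD linearZ /= tensZl; exact: addrC.
have pythagoras z (z' : 'I_n -> E) :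
    `|tens T z y0 + \sum_(i < n) tens T (z' i) (y' i)| ^+ 2
    = `|tens T z y0| ^+ 2 + `|\sum_(i < n) tens T (z' i) (y' i)| ^+ 2.
  have orth : ip (tens T z y0) (\sum_(i < n) tens T (z' i) (y' i)) = 0.
    by rewrite ip_sumr big1// => i _; rewrite tens_ip y0y' mulr0.
  rewrite -!ip_norm ipDl !ipDr (ip_conj (tens T z y0) (\sum_i _)) orth conjC0.
  by rewrite addr0 add0r.
rewrite (split_sum (S \o x)) (split_sum x) /= !pythagoras mulrDr.
have -> : S (x ord0) + \sum_(i < n) a i *: S (x (lift ord0 i)) =
    S (x ord0 + \sum_(i < n) a i *: x (lift ord0 i)).
  by rewrite linearD linear_sum; congr (_ + _); apply: eq_bigr => i _; rewrite linearZ.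
rewrite lerD// !norm_tens !exprMn mulrA ler_wpM2r ?exprn_ge0//.
by rewrite -exprMn ler_sqr ?nnegrE ?mulr_ge0.
Qed.

Lemma tensIP S x y : tensI T S (tens T x y) = tens T (S x) y.
Proof.
suff [A AS] : exists A : bop T T, forall x y, A (tens T x y) = tens T (S x) y.
  exact: (@xgetPex _ (bop0 T T)
    [set A : bop T T | forall x y, A (tens T x y) = tens T (S x) y]
    (ex_intro _ A AS)).
have [M M0 SM] := bop_bound S.
have [||n c i|A AE] := @bop_of_family _ T T (E * F)%type
  (fun p => tens T p.1 p.2) (fun p => tens T (S p.1) p.2) M => //.
- suff -> : range (fun p : E * F => tens T p.1 p.2) =
      [set t | exists x y, t = tens T x y] by exact: tens_dense.
  apply/seteqP; split=> [_ [[u v] _ <-]|_ [u [v ->]]]; first by exists u, v.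
  by exists (u, v).
(* Moving the coefficients into the second factor turns linear combinations into plain sums of
   tensors and leaves [S] untouched. *)
- have scale (U : E -> E) k : c k *: tens T (U (i k).1) (i k).2 =
      tens T (U (i k).1) (c k *: (i k).2) by rewrite linearZ.
  under eq_bigr do rewrite (scale S).
  under [X in _ <= M * `|X|]eq_bigr do rewrite (scale id).
  exact: tens_sum_bound.
by exists A => u v; exact: (AE (u, v)).
Qed.

Lemma tens_bop x : exists A : bop F T, forall y, A y = tens T x y.
Proof.
apply: (@bop_of_bound _ _ _ _ `|x|) => //; first exact: linearP.
by move=> y; rewrite norm_tens.
Qed.

(** The adjoint of [y |-> e \otimes y] is an operator with this property. *)
Lemma braIP e x y : braI T e (tens T x y) = ip e x *: y.
Proof.
suff [A Ae] : exists A : bop T F, forall x y, A (tens T x y) = ip e x *: y.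
  exact: (@xgetPex _ (bop0 T F)
    [set A : bop T F | forall x y, A (tens T x y) = ip e x *: y]
    (ex_intro _ A Ae)).
have [K KE] := tens_bop e; exists (adj K) => u v; apply: ip_inj => z.
by rewrite -adjP KE tens_ip ipZr.
Qed.

Lemma braI_adj e y t : ip y (braI T e t) = ip (tens T e y) t.
Proof.
have [K KE] := tens_bop e; rewrite -KE adjP; congr (ip y _).
move: t; apply: bop_tens_ext => u v; rewrite braIP; apply: ip_inj => z.
by rewrite -adjP KE tens_ip ipZr.
Qed.

Lemma tensI_adj S t t' : ip (tensI T S t) t' = ip t (tensI T (adj S) t').
Proof.
rewrite adjP; congr (ip t _); move: t'; apply: bop_tens_ext => x' y'.
apply: tens_total_ip => x y.
by rewrite -adjP !tensIP !tens_ip adjP.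
Qed.

Lemma tensI_comp S S' t : tensI T (bcomp S S') t = tensI T S (tensI T S' t).
Proof.
rewrite -[RHS]/(bcomp (tensI T S) (tensI T S') t).
by move: t; apply: bop_tens_ext => x y; rewrite /= !tensIP.
Qed.

(** This factorization through [F] is what turns [Khat] into inner products of the vectors [gam]. *)
Lemma tensI_rank1 e x t : tensI T (rank1 e x) t = tens T e (braI T x t).
Proof.
have [K KE] := tens_bop e.
rewrite -KE -[RHS]/(bcomp K (braI T x) t).
move: t; apply: bop_tens_ext => u v.
by rewrite /= tensIP braIP KE /= /rank1_fun tensZl linearZ.
Qed.

End Tensor.

(** * Geometric and one-term series of complex numbers *)

Lemma cvg_expr_complex (R : realType) (x : R[i]) : `|x| < 1 ->
  (fun n => x ^+ n : R[i]^o) @ \oo --> (0 : R[i]^o).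
Proof.
move=> x1; have [r rE] : exists r : R, `|x| = r%:C.
  by apply/complex_realP; exact: normr_real.
have r1 : `|r| < 1.
  by rewrite ger0_norm; [rewrite -ltcR -rE|rewrite -ler0c -rE].
apply/cvgrPdist_lt => e e0.
have /complex_realP[a aE] := gtr0_real e0.
have a0 : 0 < a by rewrite -ltcR -aE.
have /cvgrPdist_lt /(_ _ a0) := cvg_expr r1.
apply: filterS => n; rewrite !sub0r !normrN normrX normrX rE aE -rmorphXn /= ltcR.
by rewrite -normrX; apply: le_lt_trans; exact: ler_norm.
Qed.

Lemma cvg_geometric_series_complex (R : realType) (x : R[i]) : `|x| < 1 ->
  series (fun n => x ^+ n : R[i]^o) @ \oo --> ((1 - x)^-1 : R[i]^o).
Proof.
move=> x1; have x1N0 : 1 - x != 0.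
  by apply: contraTneq x1 => /subr0_eq <-; rewrite normr1 ltxx.
have -> : series (fun n => x ^+ n : R[i]^o) =
    (fun n => (1 - x)^-1 - (1 - x)^-1 * x ^+ n : R[i]^o).
  apply/funext => n; rewrite /series /= big_mkord.
  apply: (mulfI x1N0); rewrite mulrBr !mulVKf// mulfV//.
  by rewrite -opprB mulNr -subrX1 opprB.
rewrite -[X in _ --> X]subr0 -[X in _ --> _ - X](mulr0 (1 - x)^-1).
apply: cvgB; first exact: cvg_cst.
by apply: cvgMr; exact: cvg_expr_complex.
Qed.

Lemma cvg_series_delta (R : realType) (n : nat) (c : nat -> R[i]) :
  (forall m, m != n -> c m = 0) ->
  series (c : nat -> R[i]^o) @ \oo --> (c n : R[i]^o).
Proof.
move=> c0; apply: cvg_near_cst; exists n.+1 => // k /= nk.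
rewrite /series /= (bigD1_seq n) ?iota_uniq ?mem_index_iota//=.
by rewrite big1 ?addr0// => m /c0.
Qed.

(** * Monomials and Szego kernels in the Hardy space *)

Section Hardy.
Context {R : realType} (H2 : hardySpace R).

(** [hardy_full] supplies an element with these coefficients, and uniqueness of limits identifies it
    with [g]; hence [elt_of] does not fall back on 0. *)
Lemma elt_of_power_series (a : nat -> R[i]) (g : disk R -> R[i]) :
    cvgn (series (fun n => `|a n| ^+ 2 : R[i]^o)) -> power_series a g ->
  power_series a (feval (elt_of H2 g)).
Proof.
move=> a2 ag; have [h ah] := hardy_full H2 a2.
have hg : exists h : H2, forall z, feval h z = g z.
  exists h => z; apply: cvg_unique (ah z) (ag z).
  exact: norm_hausdorff.
suff -> : feval (elt_of H2 g) = g by [].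
apply/funext.
exact: (@xgetPex _ 0 [set h : H2 | forall z, feval h z = g z] hg).
Qed.

Lemma monom_power_series n :
  power_series (fun m => (m == n)%:R) (feval (monom H2 n)).
Proof.
apply: elt_of_power_series => [|z].
  apply/cvg_ex; exists (`|(n == n)%:R| ^+ 2).
  by apply: cvg_series_delta => m /negbTE ->; rewrite normr0 expr0n.
have := @cvg_series_delta R n (fun m => (m == n)%:R * val z ^+ m).
rewrite eqxx mul1r; apply=> m /negbTE ->; exact: mul0r.
Qed.

Lemma szego_power_series w :
  power_series (fun m => (val w)^* ^+ m) (feval (szego_at H2 w)).
Proof.
have w1 : `|(val w)^*| < 1 by rewrite norm_conjC; exact: (valP w).
apply: elt_of_power_series => [|z].
  apply/cvg_ex; exists ((1 - `|(val w)^*| ^+ 2)^-1).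
  under eq_fun do rewrite normrX -exprM mulnC exprM.
  by apply: cvg_geometric_series_complex; rewrite normrX normr_id exprn_ilt1.
under eq_fun do rewrite -exprMn mulrC.
apply: cvg_geometric_series_complex; rewrite normrM.
by rewrite mulr_ilt1// (valP z).
Qed.

Lemma ip_monom n (h : H2) b : power_series b (feval h) -> ip (monom H2 n) h = b n.
Proof.
move=> bh; have ipE := hardy_ip (@monom_power_series n) bh.
apply: cvg_unique ipE _; first exact: norm_hausdorff.
have := @cvg_series_delta R n (fun m => ((m == n)%:R)^* * b m).
by rewrite eqxx conjC1 mul1r; apply=> m /negbTE ->; rewrite conjC0 mul0r.
Qed.

Lemma ip_monom_szego n w : ip (monom H2 n) (szego_at H2 w) = (val w)^* ^+ n.
Proof. by apply: ip_monom; exact: szego_power_series. Qed.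

End Hardy.

(** * Both kernels as Gram kernels *)

Section Kernels.
Context {R : realType} {H2 : hardySpace R} {Hf : hilbertType R}.
Context {T : tensorProduct H2 Hf} (V : bop H2 T).

Lemma Kf_ip S a S' b :
  Kf V (S, a) (S', b) = ip (tensI T S (V a)) (tensI T S' (V b)).
Proof. by rewrite /Kf /Phi /= -adjP tensI_comp -tensI_adj. Qed.

Lemma Khat_ip m a n b : Khat V (m, a) (n, b) = ip (gam V m a) (gam V n b).
Proof.
by rewrite /Khat /Phi /= -adjP tensI_rank1 ip_conj -braI_adj -ip_conj.
Qed.

End Kernels.

Theorem proposition4p3 (R : realType) (f : disk R -> disk R)
    (hf : holomorphic f)
    (H2 : hardySpace R) (Hf : rkhs (dbr_kernel f)) (T : tensorProduct H2 Hf)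
    (V : bop H2 T) (V_isometry : isometric V)
    (V_szego : forall w : disk R,
      V (szego_at H2 w) = tens T (szego_at H2 (f w)) (sect Hf w))
    (HK : rkhs (Kf V)) (HKhat : rkhs (Khat V)) :
  (exists U : bop HK T, unitary U /\
     forall (S : bop H2 H2) (a : H2), U (sect HK (S, a)) = tensI T S (V a)) /\
  (exists Uhat : bop HKhat Hf, unitary Uhat /\
     forall (n : nat) (a : H2), Uhat (sect HKhat (n, a)) = gam V n a) /\
  (forall (n : nat) (w : disk R),
     gam V n (szego_at H2 w) = ((val (f w))^* ^+ n) *: sect Hf w).
Proof.
have gam_szego n w : gam V n (szego_at H2 w) = (val (f w))^* ^+ n *: sect Hf w.
  by rewrite /gam V_szego braIP ip_monom_szego.
split; last split=> //.
- pose h (p : bop H2 H2 * H2) := tensI T p.1 (V p.2).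
  have [[S a] [S' b]|y hy|U [unitaryU UE]] :=
      @unitary_of_family _ HK T _ (sect HK) h (@sect_dense _ _ _ HK).
  + by rewrite -feval_repr feval_sect Kf_ip.
  + apply: tens_total_ip => x v; rewrite ip0r.
    (* The exponent 0 removes the factor depending on [f w], even where [f w] vanishes. *)
    have x0 w : ip (tens T x (sect Hf w)) y = 0.
      have := hy (rank1 x (monom H2 0), szego_at H2 w).
      by rewrite /h /= V_szego tensI_rank1 braIP ip_monom_szego expr0 scale1r.
    (* For fixed [x], [<x, .> \otimes I] maps [y] to a vector orthogonal to every section of [Hf],
       so totality is needed in [Hf] only. *)
    rewrite -braI_adj ip_conj (_ : braI T x y = 0) ?ip0l ?conjC0//.
    apply: (total_ip_eq0 (@sect_dense _ _ _ Hf)) => _ [w _ <-].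
    by rewrite braI_adj.
  by exists U; split=> // S a; exact: (UE (S, a)).
- pose h (p : nat * H2) := gam V p.1 p.2.
  have [[n a] [m b]|y hy|U [unitaryU UE]] :=
      @unitary_of_family _ HKhat Hf _ (sect HKhat) h (@sect_dense _ _ _ HKhat).
  + by rewrite -feval_repr feval_sect Khat_ip.
  + apply: (total_ip_eq0 (@sect_dense _ _ _ Hf)) => _ [w _ <-].
    have := hy (0%N, szego_at H2 w).
    by rewrite /h gam_szego expr0 scale1r.
  by exists U; split=> // n a; exact: (UE (n, a)).
Qed.
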